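(* Let $\Lambda$ be a system of $\mathcal{L}(\bullet)$ (respectively of $\mathcal{L}(W)$, of $\mathcal{L}(\bullet,W)$). If $\Lambda$ is sound and strongly complete with respect to the class of monotone neighborhood frames, then so is, for the corresponding language extended with public announcements interpreted under intersection semantics, the system $\Lambda$ plus $\texttt{AP}$, $\texttt{AN}$, $\texttt{AC}$, $\texttt{AA}$ and $\texttt{A}\bullet$ (respectively $\Lambda$ plus $\texttt{AP}$, $\texttt{AN}$, $\texttt{AC}$, $\texttt{AA}$ and $\texttt{AW}$; $\Lambda$ plus $\texttt{AP}$, $\texttt{AN}$, $\texttt{AC}$, $\texttt{AA}$, $\texttt{A}\bullet$ and $\texttt{AW}$).
   Context: Fix a nonempty set $\mathbf{P}$ of propositional variables, $p\in\mathbf{P}$. $\mathcal{L}(\bullet)$: $\varphi::=p\mid\neg\varphi\mid\varphi\land\varphi\mid\bullet\varphi$; $\mathcal{L}(W)$: the same with $W\varphi$ in place of $\bullet\varphi$; $\mathcal{L}(\bullet,W)$: with both $\bullet\varphi$ and $W\varphi$. Other Boolean connectives are defined as usual; $\circ\varphi$ abbreviates $\neg\bullet\varphi$. The extension with public announcements of each language adds the formation rule: $[\psi]\varphi$ is a formula whenever $\psi,\varphi$ are. A neighborhood frame is $\langle S,N\rangle$ with $S$ a nonempty set and $N:S\to\mathcal{P}(\mathcal{P}(S))$; a model $\mathcal{M}=\langle S,N,V\rangle$ adds $V:\mathbf{P}\to\mathcal{P}(S)$. It is monotone if for all $s\in S$, $X\in N(s)$ and $X\subseteq Y\subseteq S$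 imply $Y\in N(s)$. With $\varphi^{\mathcal{M}}=\{s\in S\mid\mathcal{M},s\vDash\varphi\}$: $\mathcal{M},s\vDash p$ iff $s\in V(p)$; Boolean connectives as usual; $\mathcal{M},s\vDash\bullet\varphi$ iff $s\in\varphi^{\mathcal{M}}$ and $\varphi^{\mathcal{M}}\notin N(s)$; $\mathcal{M},s\vDash W\varphi$ iff $\varphi^{\mathcal{M}}\in N(s)$ and $s\notin\varphi^{\mathcal{M}}$. Intersection semantics, for monotone $\mathcal{M}$: $\mathcal{M},s\vDash[\psi]\varphi$ iff ($\mathcal{M},s\vDash\psi$ implies $\mathcal{M}^{\cap\psi},s\vDash\varphi$), where $\mathcal{M}^{\cap\psi}=\mathcal{M}^{\cap X}$ with $X=\psi^{\mathcal{M}}$, and for nonempty $X\subseteq S$, $\mathcal{M}^{\cap X}=\langle X,N^{\cap X},V^X\rangle$ with $N^{\cap X}(s)=\{P\cap X\mid P\in N(s)\}$ for $s\in X$ and $V^X(p)=V(p)\cap X$ (this model is again monotone). Reduction axioms (schemes, $p\in\mathbf{P}$): $\texttt{AP}$: $[\psi]p\leftrightarrow(\psi\to p)$; $\texttt{AN}$: $[\psi]\neg\varphi\leftrightarrow(\psi\to\neg[\psi]\varphi)$; $\texttt{AC}$: $[\psi](\varphi\land\chi)\leftrightarrow([\psi]\varphi\land[\psi]\chi)$; $\texttt{AA}$: $[\psi][\chi]\varphi\leftrightarrow[\psi\land[\psi]\chi]\varphi$; $\texttt{A}\bullet$: $[\psi]\bullet\varphi\leftrightarrow(\psi\to\bullet[\psi]\varphi)$;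 $\texttt{AW}$: $[\psi]W\varphi\leftrightarrow(\psi\to W[\psi]\varphi)$. A system is a Hilbert-style system given by axiom schemes and rule schemes whose metavariables range over formulas, containing all propositional tautologies, modus ponens, and replacement of equivalents for the modalities of its language ($\texttt{RE}\circ$: from $\varphi\leftrightarrow\psi$ infer $\circ\varphi\leftrightarrow\circ\psi$; $\texttt{REW}$: from $\varphi\leftrightarrow\psi$ infer $W\varphi\leftrightarrow W\psi$; rules applied to theorems). In $\Lambda$ plus reduction axioms, all schemes are instantiated with formulas of the extended language. Sound with respect to a class of frames: every theorem is true at every state of every model based on a frame in the class. Strongly complete: for every set $\Gamma\cup\{\varphi\}$ of formulas of the language, if $\varphi$ is true at every state, in every model based on a frame in the class, at which all of $\Gamma$ is true, then $\vdash\bigwedge\Gamma_0\to\varphi$ for some finite $\Gamma_0\subseteq\Gamma$. *)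

(* Defs.v *)
From Stdlib Require List.
From mathcomp Require Import all_boot.
From mathcomp Require Import boolp classical_sets.

Set Implicit Arguments.
Unset Strict Implicit.
Unset Printing Implicit Defensive.

Local Open Scope classical_set_scope.

(* L(bullet), L(W) and L(bullet, W). *)
Variant lang := LBullet | LWrong | LBulletWrong.

Definition has_bullet (L : lang) : bool :=
  match L with LBullet | LBulletWrong => true | LWrong => false end.

Definition has_wrong (L : lang) : bool :=
  match L with LWrong | LBulletWrong => true | LBullet => false end.

(* [form P L false] is the language L over the propositional variables P, and
   [form P L true] its extension with public announcements: [Ann _ psi phi]
   is the formula [psi]phi. *)
Inductive form (P : Type) (L : lang) (pa : bool) : Type :=
| Var of P
| Neg of form P L pa
| And of form P L pa & form P L pa
| Bullet of has_bullet L & form P L pa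
| Wrong of has_wrong L & form P L pa
| Ann of pa & form P L pa & form P L pa.

Arguments Var {P L pa}.

Definition Imp (P : Type) (L : lang) (pa : bool) (f g : form P L pa) :=
  Neg (And f (Neg g)).
Definition Iff (P : Type) (L : lang) (pa : bool) (f g : form P L pa) :=
  And (Imp f g) (Imp g f).
Definition Circ (P : Type) (L : lang) (pa : bool) (h : has_bullet L)
    (f : form P L pa) :=
  Neg (Bullet h f).
Definition Top (P : Type) (L : lang) (pa : bool) (p0 : P) : form P L pa :=
  Imp (Var p0) (Var p0).
Definition Conj (P : Type) (L : lang) (pa : bool) (p0 : P)
    (G : seq (form P L pa)) : form P L pa :=
  foldr (@And P L pa) (Top L pa p0) G.

Record frame := Frame {
  world :> Type;
  world_nonempty : [set: world] !=set0;
  nbhd : world -> set (set world) }.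

Record model (P : Type) := Model {
  frame_of :> frame;
  valuation : P -> set frame_of }.

Definition monotone_frame (F : frame) : Prop :=
  forall (s : F) (X Y : set F), nbhd s X -> X `<=` Y -> nbhd s Y.

Lemma set_type_nonempty (T : Type) (X : set T) :
  X !=set0 -> [set: X] !=set0.
Proof. by case=> x Xx; exists (SigSub (mem_set Xx)). Qed.

(* The new set of states is the subtype of the elements of X; a subset Q of
   the old states meets it in [val @^-1` (Q `&` X)]. *)
Definition update_frame (F : frame) (X : set F) (X0 : X !=set0) : frame :=
  {| world := X;
     world_nonempty := set_type_nonempty X0;
     nbhd := fun s : X =>
       [set (val : X -> F) @^-1` (Q `&` X) | Q in nbhd (val s)] |}.

Definition update (P : Type) (M : model P) (X : set M) (X0 : X !=set0) :
    model P :=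
  {| frame_of := update_frame X0;
     valuation := fun p =>
       (val : X -> M) @^-1` (valuation (m := M) p `&` X) |}.

Unset Implicit Arguments.

(* In the last clause, s itself witnesses that the truth set of g is
   nonempty. *)
Fixpoint sat {P : Type} {L : lang} {pa : bool} (M : model P)
    (f : form P L pa) {struct f} : set M :=
  match f with
  | Var p => valuation (m := M) p
  | Neg g => ~` sat M g
  | And g h => sat M g `&` sat M h
  | Bullet _ g => [set s | sat M g s /\ ~ nbhd s (sat M g)]
  | Wrong _ g => [set s | nbhd s (sat M g) /\ ~ sat M g s]
  | Ann _ g h =>
      [set s | forall gs : sat M g s,
        sat (update (ex_intro _ s gs)) h (SigSub (mem_set gs))]
  end.

Set Implicit Arguments.

(* A scheme is built from metavariables ranging over formulas, and possibly
   fixed propositional variables (such as the one used to define Top). *)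
Inductive scheme (P : Type) (L : lang) : Type :=
| SMeta of nat
| SVar of P
| SNeg of scheme P L
| SAnd of scheme P L & scheme P L
| SBullet of has_bullet L & scheme P L
| SWrong of has_wrong L & scheme P L.

Fixpoint inst (P : Type) (L : lang) (pa : bool) (sigma : nat -> form P L pa)
    (A : scheme P L) : form P L pa :=
  match A with
  | SMeta n => sigma n
  | SVar p => Var p
  | SNeg B => Neg (inst sigma B)
  | SAnd B C => And (inst sigma B) (inst sigma C)
  | SBullet h B => Bullet h (inst sigma B)
  | SWrong h B => Wrong h (inst sigma B)
  end.

(* The schemes of a system besides propositional tautologies, modus ponens and
   replacement of equivalents, which [derivable] supplies for every system. A
   rule is a finite list of premises and a conclusion. *)
Record system (P : Type) (L : lang) := System {
  axioms : set (scheme P L);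
  rules : set (seq (scheme P L) * scheme P L) }.

(* Variables, modal formulas and announcements count as atoms. *)
Fixpoint beval (P : Type) (L : lang) (pa : bool) (v : form P L pa -> bool)
    (f : form P L pa) : bool :=
  match f with
  | Neg g => ~~ beval v g
  | And g h => beval v g && beval v h
  | _ => v f
  end.

Definition tautology (P : Type) (L : lang) (pa : bool) (f : form P L pa) :
    Prop :=
  forall v : form P L pa -> bool, beval v f.

Inductive reduction_axiom (P : Type) (L : lang) : set (form P L true) :=
| AP psi p :
    reduction_axiom (Iff (Ann isT psi (Var p)) (Imp psi (Var p)))
| AN psi phi :
    reduction_axiom (Iff (Ann isT psi (Neg phi))
                         (Imp psi (Neg (Ann isT psi phi))))
| AC psi phi chi :
    reduction_axiom (Iff (Ann isT psi (And phi chi))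
                         (And (Ann isT psi phi) (Ann isT psi chi)))
| AA psi chi phi :
    reduction_axiom (Iff (Ann isT psi (Ann isT chi phi))
                         (Ann isT (And psi (Ann isT psi chi)) phi))
| ABullet (h : has_bullet L) psi phi :
    reduction_axiom (Iff (Ann isT psi (Bullet h phi))
                         (Imp psi (Bullet h (Ann isT psi phi))))
| AWrong (h : has_wrong L) psi phi :
    reduction_axiom (Iff (Ann isT psi (Wrong h phi))
                         (Imp psi (Wrong h (Ann isT psi phi)))).

(* The theorems obtained when the schemes of Lam are instantiated with formulas
   of [form P L pa] and the formulas in Ax are taken as further axioms. *)
Inductive derivable (P : Type) (L : lang) (pa : bool) (Lam : system P L)
    (Ax : set (form P L pa)) : set (form P L pa) :=
| der_taut f : tautology f -> derivable Lam Ax f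
| der_extra f : Ax f -> derivable Lam Ax f
| der_axiom A (sigma : nat -> form P L pa) :
    axioms Lam A -> derivable Lam Ax (inst sigma A)
| der_rule As B (sigma : nat -> form P L pa) :
    rules Lam (As, B) ->
    (forall A, List.In A As -> derivable Lam Ax (inst sigma A)) ->
    derivable Lam Ax (inst sigma B)
| der_MP f g :
    derivable Lam Ax (Imp f g) -> derivable Lam Ax f -> derivable Lam Ax g
| der_RECirc (h : has_bullet L) f g :
    derivable Lam Ax (Iff f g) -> derivable Lam Ax (Iff (Circ h f) (Circ h g))
| der_REW (h : has_wrong L) f g :
    derivable Lam Ax (Iff f g) ->
    derivable Lam Ax (Iff (Wrong h f) (Wrong h g)).

Definition theorems (P : Type) (L : lang) (Lam : system P L) :
    set (form P L false) :=
  derivable Lam set0.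

Definition pa_theorems (P : Type) (L : lang) (Lam : system P L) :
    set (form P L true) :=
  derivable Lam (@reduction_axiom P L).

Definition sound (P : Type) (L : lang) (pa : bool) (C : frame -> Prop)
    (Thm : set (form P L pa)) : Prop :=
  forall f, Thm f -> forall M : model P, C M -> forall s : M, sat M f s.

(* A finite subset of Gam is given by a list of its elements. *)
Definition strongly_complete (P : Type) (L : lang) (pa : bool) (p0 : P)
    (C : frame -> Prop) (Thm : set (form P L pa)) : Prop :=
  forall (Gam : set (form P L pa)) (f : form P L pa),
    (forall M : model P, C M -> forall s : M,
      (forall g, Gam g -> sat M g s) -> sat M f s) ->
    exists2 G0 : seq (form P L pa),
      forall g, List.In g G0 -> Gam g & Thm (Imp (Conj p0 G0) f).

(* Main.v *)
(** Since [AA] turns [[psi][chi]phi] into [[psi /\ [psi]chi]phi], a recursion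
    on [phi] eliminates the announcement from [[psi]phi], even though no
    replacement rule for announcements is available.  The resulting translation
    commutes with all other connectives, hence with instances of schemes, and
    sends every reduction axiom to some [a <-> a]; so it sends derivations in
    the extended system to derivations in [Lam], which gives soundness also
    when the rules of [Lam] preserve theoremhood only.  Completeness is pulled
    back along the translation, as each formula is provably, hence
    semantically, equivalent to its translation: the reduction axioms suffice
    for this proof, and they are sound. *)
Require Import Defs.
From Stdlib Require List.
From mathcomp Require Import all_boot.
From mathcomp Require Import boolp classical_sets.

Set Implicit Arguments.
Unset Strict Implicit.
Unset Printing Implicit Defensive.

Local Open Scope classical_set_scope.

(** * The translation eliminating announcements *)

(* The target [pa'] is arbitrary: [pa' = false] gives the translation into the
   announcement-free language, and the instance with [pa = false] is the
   inclusion of that language into the extended one. *)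
Fixpoint reduce_ann (P : Type) (L : lang) (pa pa' : bool) (a : form P L pa')
    (f : form P L pa) : form P L pa' :=
  match f with
  | Var p => Imp a (Var p)
  | Neg g => Imp a (Neg (reduce_ann a g))
  | And g h => And (reduce_ann a g) (reduce_ann a h)
  | Bullet b g => Imp a (Bullet b (reduce_ann a g))
  | Wrong w g => Imp a (Wrong w (reduce_ann a g))
  | Ann _ g h => reduce_ann (And a (reduce_ann a g)) h
  end.

Fixpoint reduce (P : Type) (L : lang) (pa pa' : bool) (f : form P L pa) :
    form P L pa' :=
  match f with
  | Var p => Var p
  | Neg g => Neg (reduce pa' g)
  | And g h => And (reduce pa' g) (reduce pa' h)
  | Bullet b g => Bullet b (reduce pa' g)
  | Wrong w g => Wrong w (reduce pa' g)
  | Ann _ g h => reduce_ann (reduce pa' g) h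
  end.

Lemma reduce_reduce_ann (P : Type) (L : lang) (pa pa' pa'' : bool)
    (f : form P L pa) (a : form P L pa') :
  reduce pa'' (reduce_ann a f) = reduce_ann (reduce pa'' a) f.
Proof.
elim: f a => [p|g IHg|g IHg h IHh|b g IHg|w g IHg|x g IHg h IHh] a //=;
  by rewrite ?IHh /= ?IHg.
Qed.

(** Used to pass through the announcement-free language: translating into it and including the
    result back agrees with translating inside the extended language. *)
Lemma reduce_reduce (P : Type) (L : lang) (pa pa' pa'' : bool)
    (f : form P L pa) :
  reduce pa'' (reduce pa' f) = reduce pa'' f.
Proof.
elim: f => [p|g IHg|g IHg h IHh|b g IHg|w g IHg|x g IHg h IHh] //=;
  by rewrite ?reduce_reduce_ann ?IHg ?IHh.
Qed.

Lemma reduce_inst (P : Type) (L : lang) (pa pa' : bool)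
    (sigma : nat -> form P L pa) (A : scheme P L) :
  reduce pa' (inst sigma A) = inst (reduce pa' \o sigma) A.
Proof. by elim: A => //= [A ->|A -> B ->|b A ->|w A ->]. Qed.

Lemma reduce_Conj (P : Type) (L : lang) (pa pa' : bool) (p0 : P)
    (G : seq (form P L pa)) :
  reduce pa' (Conj p0 G) = Conj p0 (map (reduce pa') G).
Proof. by elim: G => //= g G ->. Qed.

(** Announcements are atoms for [beval], so a valuation pulls back by giving each of them the value
    of its whole translation; hence tautologies translate to tautologies. *)
Lemma beval_reduce (P : Type) (L : lang) (pa pa' : bool)
    (v : form P L pa' -> bool) (f : form P L pa) :
  beval v (reduce pa' f) = beval (fun g => beval v (reduce pa' g)) f.
Proof. by elim: f => //= [g ->|g -> h ->]. Qed.

Ltac beval_cases := move=> ? /=; repeat case: (beval _ _) => //=.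

Lemma tautology_Iff_refl (P : Type) (L : lang) (pa : bool) (f : form P L pa) :
  tautology (Iff f f).
Proof. by beval_cases. Qed.

(** Serves in both directions: eliminating announcements for soundness, and including the theorems
    of [Lam] in the extended system for completeness. *)
Lemma derivable_reduce (P : Type) (L : lang) (pa pa' : bool)
    (Lam : system P L) (Ax : set (form P L pa)) (Ax' : set (form P L pa'))
    (f : form P L pa) :
  (forall g, Ax g -> derivable Lam Ax' (reduce pa' g)) ->
  derivable Lam Ax f -> derivable Lam Ax' (reduce pa' f).
Proof.
move=> AxP; elim=> {f}.
- by move=> f tf; apply: der_taut => v; rewrite beval_reduce; exact: tf.
- by move=> f; exact: AxP.
- by move=> A sigma LA; rewrite reduce_inst; exact: der_axiom.
- move=> As B sigma LB _ IH; rewrite reduce_inst; apply: (der_rule LB) => A /IH.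
  by rewrite reduce_inst.
- by move=> f g _ IHfg _; exact: der_MP.
- by move=> h f g _; exact: der_RECirc.
- by move=> h f g _; exact: der_REW.
Qed.

(** The two sides of each axiom compute to the same formula; for [AA] this is the announcement
    clause of [reduce_ann]. *)
Lemma tautology_reduce_axiom (P : Type) (L : lang) (pa' : bool)
    (f : form P L true) :
  reduction_axiom f -> tautology (reduce pa' f).
Proof. by case=> *; exact: tautology_Iff_refl. Qed.

(** * Provable equivalence of a formula and its translation *)

Section ProvableEquivalence.
Variables (P : Type) (L : lang) (pa : bool) (Lam : system P L).
Variable Ax : set (form P L pa).
Implicit Types a b c d : form P L pa.
Local Notation "|- a" := (derivable Lam Ax a) (at level 70).

Lemma derivable_cut1 a b : |- a -> tautology (Imp a b) -> |- b.
Proof. by move=> da tab; exact: der_MP (der_taut _ _ tab) da. Qed.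

Lemma derivable_cut2 a b c :
  |- a -> |- b -> tautology (Imp a (Imp b c)) -> |- c.
Proof. by move=> da db /(derivable_cut1 da) dbc; exact: der_MP dbc db. Qed.

Lemma derivable_Iff_trans a b c : |- Iff a b -> |- Iff b c -> |- Iff a c.
Proof. by move=> dab dbc; apply: (derivable_cut2 dab dbc); beval_cases. Qed.

Lemma derivable_Iff_Neg a b : |- Iff a b -> |- Iff (Neg a) (Neg b).
Proof. by move=> dab; apply: (derivable_cut1 dab); beval_cases. Qed.

Lemma derivable_Iff_And a b c d :
  |- Iff a b -> |- Iff c d -> |- Iff (And a c) (And b d).
Proof. by move=> dab dcd; apply: (derivable_cut2 dab dcd); beval_cases. Qed.

Lemma derivable_Iff_Imp a b c d :
  |- Iff a b -> |- Iff c d -> |- Iff (Imp a c) (Imp b d).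
Proof.
by move=> dab dcd; apply/derivable_Iff_Neg/derivable_Iff_And/derivable_Iff_Neg.
Qed.

(** The rule yields the equivalence of the negations; [Bullet] formulas are atoms, so removing the
    negations is propositional. *)
Lemma derivable_Iff_Bullet (h : has_bullet L) a b :
  |- Iff a b -> |- Iff (Bullet h a) (Bullet h b).
Proof.
move=> /(der_RECirc h) dab; apply: (derivable_cut1 dab) => v /=.
by case: (v _); case: (v _).
Qed.

End ProvableEquivalence.

(** No rule replaces equivalents inside an announcement, so the induction on [f] carries an
    arbitrary pair of provably equivalent announced formulas. *)
Lemma derivable_Iff_reduce_ann (P : Type) (L : lang) (Lam : system P L)
    (f psi a : form P L true) :
  pa_theorems Lam (Iff psi a) ->
  pa_theorems Lam (Iff (Ann isT psi f) (reduce_ann a f)).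
Proof.
rewrite /pa_theorems.
elim: f psi a =>
  [p|g IHg|g IHg h IHh|b g IHg|w g IHg|x g IHg h IHh] psi a da /=.
- apply: derivable_Iff_trans; first by apply: der_extra; exact: AP.
  by apply: derivable_Iff_Imp => //; apply: der_taut; exact: tautology_Iff_refl.
- apply: derivable_Iff_trans; first by apply: der_extra; exact: AN.
  by apply: derivable_Iff_Imp => //; apply: derivable_Iff_Neg; exact: IHg.
- apply: derivable_Iff_trans; first by apply: der_extra; exact: Defs.AC.
  by apply: derivable_Iff_And; [exact: IHg | exact: IHh].
- apply: derivable_Iff_trans; first by apply: der_extra; exact: ABullet.
  by apply: derivable_Iff_Imp => //; apply: derivable_Iff_Bullet; exact: IHg.
- apply: derivable_Iff_trans; first by apply: der_extra; exact: AWrong.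
  by apply: derivable_Iff_Imp => //; apply: der_REW; exact: IHg.
- rewrite (bool_irrelevance x isT).
  apply: derivable_Iff_trans; first by apply: der_extra; exact: AA.
  (* The hypothesis for [g] makes the two new announced formulas equivalent, as the hypothesis for
     [h] demands. *)
  by apply: IHh; apply: derivable_Iff_And => //; exact: IHg.
Qed.

Lemma derivable_Iff_reduce (P : Type) (L : lang) (Lam : system P L)
    (f : form P L true) :
  pa_theorems Lam (Iff f (reduce true f)).
Proof.
rewrite /pa_theorems.
elim: f => [p|g IHg|g IHg h IHh|b g IHg|w g IHg|x g IHg h _] /=.
- by apply: der_taut; exact: tautology_Iff_refl.
- exact: derivable_Iff_Neg.
- exact: derivable_Iff_And.
- exact: derivable_Iff_Bullet.
- exact: der_REW.
- by rewrite (bool_irrelevance x isT); exact: derivable_Iff_reduce_ann.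
Qed.

(** * Truth, isomorphic models and soundness of the reduction axioms *)

Lemma sat_Imp (P : Type) (L : lang) (pa : bool) (M : model P)
    (f g : form P L pa) (s : M) :
  sat M (Imp f g) s <-> (sat M f s -> sat M g s).
Proof.
split=> [nfg fs|fg [fs]]; last by apply; exact: fg.
by apply: contrapT => ngs; exact: nfg.
Qed.

Lemma sat_Iff (P : Type) (L : lang) (pa : bool) (M : model P)
    (f g : form P L pa) (s : M) :
  sat M (Iff f g) s <-> (sat M f s <-> sat M g s).
Proof.
split=> [[/sat_Imp ? /sat_Imp ?]|[? ?]]; first by split.
by split; apply/sat_Imp.
Qed.

Lemma sat_tautology (P : Type) (L : lang) (pa : bool) (M : model P)
    (f : form P L pa) (s : M) :
  tautology f -> sat M f s.
Proof.
suff fP (g : form P L pa) :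
    beval (fun g : form P L pa => `[< sat M g s >]) g = `[< sat M g s >].
  by move=> /(_ (fun g => `[< sat M g s >])); rewrite fP => /asboolP.
by elim: g => //= [g ->|g -> h ->]; rewrite ?asbool_neg ?asbool_and.
Qed.

(** Two updates in a row produce a nested subtype, so comparing them with a single update takes
    invariance under isomorphism. The models vary in the induction because the announcement case
    restricts [i] and [j] to the updated models. *)
Lemma sat_iso (P : Type) (L : lang) (pa : bool) (f : form P L pa)
    (M M' : model P) (i : M -> M') (j : M' -> M) :
  cancel i j -> cancel j i ->
  (forall s (Y : set M'), nbhd s (i @^-1` Y) <-> nbhd (i s) Y) ->
  (forall p s, valuation p s <-> valuation p (i s)) ->
  sat M f = i @^-1` sat M' f.
Proof.
elim: f M M' i j => [p|g IHg|g IHg h IHh|b g IHg|w g IHg|x g IHg h IHh]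
  M M' i j iK jK iN iV /=.
- by apply/seteqP; split=> s /= /iV.
- by rewrite (IHg _ _ _ _ iK jK iN iV).
- by rewrite (IHg _ _ _ _ iK jK iN iV) (IHh _ _ _ _ iK jK iN iV).
- rewrite (IHg _ _ _ _ iK jK iN iV).
  by apply/seteqP; split=> s /= [? ngs]; split=> // /iN.
- rewrite (IHg _ _ _ _ iK jK iN iV).
  by apply/seteqP; split=> s /= [/iN ? ngs]; split.
have gE := IHg _ _ _ _ iK jK iN iV.
have gi s : sat M g s -> sat M' g (i s) by rewrite gE.
have gj s : sat M' g s -> sat M g (j s) by rewrite gE /= jK.
pose i' (u : sat M g) : sat M' g := SigSub (mem_set (gi _ (set_valP u))).
pose j' (u : sat M' g) : sat M g := SigSub (mem_set (gj _ (set_valP u))).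
have i'K : cancel i' j' by move=> u; apply: val_inj; rewrite /= iK.
have j'K : cancel j' i' by move=> u; apply: val_inj; rewrite /= jK.
have hE (X0 : sat M g !=set0) (X0' : sat M' g !=set0) :
    sat (update X0) h = i' @^-1` sat (update X0') h.
  apply: (IHh (update X0) (update X0') i' j' i'K j'K)
    => [u Y|p u] /=; last first.
    have gu := @set_valP _ (sat M g) u.
    by split=> -[/iV ? _]; split=> //; exact: (gi _ gu).
  split=> [[Q NQ QY]|[Q NQ <-]].
    (* Since [i] and [j] are inverse, [Q] is the [i]-preimage of this set, and [iN] applies. *)
    exists (j @^-1` Q).
      apply/iN; rewrite (_ : _ @^-1` _ = Q) //.
      by apply/seteqP; split=> s /=; rewrite iK.
    apply/seteqP; split=> w;
      rewrite -[w]j'K -[Y _]/((i' @^-1` Y) (j' w)) -QY /=.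
      by rewrite jK => -[? _]; split=> //; exact: (gj _ (set_valP w)).
    by rewrite jK => -[? _]; split=> //; exact: set_valP w.
  exists (i @^-1` Q); first exact/iN.
  by apply/seteqP; split=> w [? _]; split=> //;
    [exact: (gi _ (set_valP w)) | exact: set_valP w].
(* [hE] accepts any witnesses of nonemptiness, here the current states; what remains differs only in
   membership proofs. *)
apply/seteqP; split=> s /= ann gs.
  have gs' : sat M g s by rewrite gE.
  have := ann gs'; rewrite (hE _ (ex_intro _ (i s) gs)) /=.
  by congr (sat _ _ _); apply: val_inj.
rewrite (hE _ (ex_intro _ (i s) (gi _ gs))) /=.
have := ann (gi _ gs).
by congr (sat _ _ _); apply: val_inj.
Qed.

(** The set on the right is the largest one whose trace on [X] is [Y], so by monotonicity it is a
    neighborhood as soon as some set with that trace is. If [Y] is the truth set of [f] after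
    announcing [psi], it is the truth set of [[psi]f]. *)
Lemma nbhd_update (F : frame) (X : set F) (X0 : X !=set0) (s : X)
    (Y : set X) :
  monotone_frame F ->
  nbhd (s : update_frame X0) Y <->
  nbhd (val s) [set x | forall Xx : X x, Y (SigSub (mem_set Xx))].
Proof.
move=> mF; split=> [[Q NQ <-]|NY].
  by apply: mF NQ _ => x Qx Xx /=; split.
exists [set x | forall Xx : X x, Y (SigSub (mem_set Xx))] => //.
have eta (w : X) (Xw : X (val w)) : SigSub (mem_set Xw) = w by exact: val_inj.
apply/seteqP; split=> w /= => [[Yw Xw]|Yw].
  by have := Yw Xw; rewrite eta.
by split=> [Xw|]; [rewrite eta | exact: set_valP w].
Qed.

(* [X0] is arbitrary, whereas [sat] takes the current state as the witness that
   the truth set of [psi] is nonempty. *)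
Lemma sat_update_lift (P : Type) (L : lang) (M : model P)
    (psi f : form P L true) (X0 : sat M psi !=set0) :
  [set x | forall psix : sat M psi x, sat (update X0) f (SigSub (mem_set psix))]
  = sat M (Ann isT psi f).
Proof.
apply/seteqP; split=> x xf psix /=; last first.
  by rewrite (Prop_irrelevance X0 (ex_intro _ x psix)); exact: xf.
by rewrite (Prop_irrelevance (ex_intro _ x psix) X0); exact: xf.
Qed.

(** Updating by [psi] and then by [chi] gives a model isomorphic to the update by [theta]; [updE]
    compares states lying over the same state of [M]. *)
Lemma sat_AA (P : Type) (L : lang) (M : model P) (psi chi f : form P L true) :
  sat M (Ann isT psi (Ann isT chi f))
  = sat M (Ann isT (And psi (Ann isT psi chi)) f).
Proof.
set theta := And psi (Ann isT psi chi).
have updE (X0 : sat M psi !=set0) (Y0 : sat (update X0) chi !=set0)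
    (Z0 : sat M theta !=set0) (u : update Y0) (v : update Z0) :
    val (val u) = val v -> sat (update Y0) f u <-> sat (update Z0) f v.
  (* On states of [psi], surviving the second update amounts to satisfying [[psi]chi]; this makes
     [i] and [j] well defined. *)
  have chiP (w : sat M psi) : sat M (Ann isT psi chi) (val w)
      <-> sat (update X0) chi w.
    rewrite -(sat_update_lift chi X0) /=.
    have eta (Xw : sat M psi (val w)) : SigSub (mem_set Xw) = w.
      exact: val_inj.
    split=> [/(_ (set_valP w))|cw Xw]; by rewrite eta.
  have iP (w : sat (update X0) chi) : sat M theta (val (val w)).
    by split; [exact: set_valP | apply/chiP; exact: set_valP].
  pose i (w : sat (update X0) chi) : sat M theta := SigSub (mem_set (iP w)).
  have jP (w : sat M theta) :
      sat (update X0) chi (SigSub (mem_set (set_valP w).1)).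
    by apply/chiP; exact: (set_valP w).2.
  pose j (w : sat M theta) : sat (update X0) chi := SigSub (mem_set (jP w)).
  have iK : cancel i j by move=> w; do 2 apply: val_inj.
  have jK : cancel j i by move=> w; apply: val_inj.
  move=> uv; rewrite (_ : v = i u); last by apply: val_inj; rewrite -uv.
  rewrite (@sat_iso _ _ _ f (update Y0) (update Z0) i j iK jK) //.
    (* Intersecting [R] with [psi] and then with [chi] leaves its trace on [theta], so one
       neighborhood of [M] witnesses both sides. *)
    move=> w Y; split=> [[Q [R NR <-] RY]|[Q NQ <-]].
      exists R => //; apply/seteqP; split=> z; rewrite -[z]jK.
        move=> [Rz _]; rewrite -[Y _]/((i @^-1` Y) (j z)) -RY.
        by split; [split=> //; exact: set_valP | exact: set_valP].
      rewrite -[Y _]/((i @^-1` Y) (j z)) -RY => -[[Rz _] _].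
      by split=> //; exact: set_valP.
    exists ((val : sat M psi -> M) @^-1` (Q `&` sat M psi)); first by exists Q.
    apply/seteqP; split=> z [].
      by move=> [Qz _] _; split=> //; exact: iP.
    by move=> Qz _; split; [split=> //; exact: set_valP | exact: set_valP].
  move=> p w; split=> [[[? _] _]|[? _]]; first by split=> //; exact: iP.
  by split; [split=> //; exact: set_valP | exact: set_valP].
apply/seteqP; split=> s sf.
  move=> [psis chis].
  by have /updE := sf psis (chis psis); apply.
move=> psis chis.
have chis' : sat M (Ann isT psi chi) s.
  by move=> psis'; rewrite (Prop_irrelevance psis' psis).
by have := sf (conj psis chis'); apply: (updE _ _ _ _ _ _).2.
Qed.

Lemma sat_reduction_axiom (P : Type) (L : lang) (M : model P)
    (f : form P L true) (s : M) :
  monotone_frame M -> reduction_axiom f -> sat M f s.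
Proof.
move=> mM; case=> [psi p|psi phi|psi phi chi|psi chi phi|h psi phi|h psi phi];
  apply/sat_Iff; rewrite ?sat_Imp.
- by split=> H psis; have := H psis; [case | split].
- split=> H psis; first by move=> /(_ psis); exact: H.
  move=> phis; apply: (H psis) => psis'.
  by rewrite (Prop_irrelevance psis' psis).
- split=> [H|[H H'] psis]; last by split; [exact: H | exact: H'].
  by split=> psis; have [] := H psis.
- by rewrite sat_AA.
- split=> H psis.
    have [phis nphi] := H psis; split=> [psis'|].
      by rewrite (Prop_irrelevance psis' psis).
    by move: nphi; rewrite nbhd_update // sat_update_lift.
  have [phis nphi] := H psis; split; first exact: phis.
  by rewrite nbhd_update // sat_update_lift.
- split=> H psis.
    have [nphi phis] := H psis; split; last by move=> /(_ psis).
    by move: nphi; rewrite nbhd_update // sat_update_lift.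
  have [nphi phis] := H psis; split.
    by rewrite nbhd_update // sat_update_lift.
  move=> phis'; apply: phis => psis'.
  by rewrite (Prop_irrelevance psis' psis).
Qed.

(** The system without schemes suffices because [derivable_Iff_reduce] holds for every [Lam]. Truth
    throughout the fixed model [M] is preserved by all its rules, with no appeal to the rules of
    [Lam]. *)
Lemma sat_derivable_no_schemes (P : Type) (L : lang) (M : model P)
    (f : form P L true) :
  monotone_frame M -> pa_theorems (System set0 set0) f ->
  forall s : M, sat M f s.
Proof.
move=> mM; elim=> {f}
  [f tf s|f Axf s|//|//|f g _ fg _ fs s|h f g _ fg s|h f g _ fg s].
- exact: sat_tautology.
- exact: sat_reduction_axiom.
- by have /sat_Imp := fg s; apply; exact: fs.
- have E : sat M f = sat M g.
    by apply/seteqP; split=> t; have /sat_Iff [] := fg t.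
  by apply/sat_Iff; rewrite /= E.
- have E : sat M f = sat M g.
    by apply/seteqP; split=> t; have /sat_Iff [] := fg t.
  by apply/sat_Iff; rewrite /= E.
Qed.

(** * Transfer of soundness and strong completeness *)

Lemma sat_reduce_ann_free (P : Type) (L : lang) (pa : bool) (M : model P)
    (f : form P L false) :
  sat M (reduce pa f) = sat M f.
Proof. by elim: f => //= [g ->|g -> h ->|b g ->|w g ->]. Qed.

(** Instead of a semantic induction on [f], the provable equivalence of [f] with [reduce true f] is
    read in [M]. *)
Lemma sat_reduce (P : Type) (L : lang) (M : model P) (f : form P L true)
    (s : M) :
  monotone_frame M -> sat M (reduce false f) s <-> sat M f s.
Proof.
move=> mM; rewrite -(sat_reduce_ann_free true) reduce_reduce.
apply: iff_sym; apply/sat_Iff.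
by apply: sat_derivable_no_schemes => //; exact: derivable_Iff_reduce.
Qed.

Lemma seq_preimage (T U : Type) (f : T -> U) (A : set T) (s : seq U) :
  (forall y, List.In y s -> (f @` A) y) ->
  exists2 r : seq T, forall x, List.In x r -> A x & map f r = s.
Proof.
elim: s => [|y s IH] sA; first by exists [::].
have [|r rA rs] := IH; first by move=> z zs; apply: sA; right.
have [x Ax xy] := sA y (or_introl erefl).
exists (x :: r) => [z [<- //|]|]; first exact: rA.
by rewrite /= xy rs.
Qed.

Theorem theorem6p3 (P : Type) (p0 : P) (L : lang) (Lam : system P L) :
  sound monotone_frame (theorems Lam) ->
  strongly_complete p0 monotone_frame (theorems Lam) ->
  sound monotone_frame (pa_theorems Lam) /\
  strongly_complete p0 monotone_frame (pa_theorems Lam).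
Proof.
move=> Lam_sound Lam_complete; split=> [f df M mM s|Gam f Gamf].
  apply/(sat_reduce f s mM); apply: Lam_sound => //.
  apply: derivable_reduce df => g Axg.
  exact: der_taut (tautology_reduce_axiom Axg).
have [M mM s sGam|G0 G0P dG0] :=
  Lam_complete (reduce false @` Gam) (reduce false f).
  apply/(sat_reduce f s mM); apply: Gamf => // g Gg.
  by apply/(sat_reduce g s mM); apply: sGam; exists g.
have [G GP GG0] := seq_preimage G0P.
exists G => //.
(* The derivation in [Lam] is included in the extended system, where [derivable_Iff_reduce] undoes
   the translation. *)
have {dG0} : pa_theorems Lam (reduce true (reduce false (Imp (Conj p0 G) f))).
  by apply: (derivable_reduce (Ax := set0)) => //; rewrite /= reduce_Conj GG0.
rewrite reduce_reduce => dG.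
apply: (derivable_cut2 (derivable_Iff_reduce Lam (Imp (Conj p0 G) f)) dG).
by beval_cases.
Qed.
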